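(* Let $f:\mathbb{X}\to\mathbb{R}^{m\times n}$ be a query function and let $s_2(f)$ be its $\ell_2$-sensitivity. Let $\varepsilon>0$ and $\delta\in(0,1)$, and let $B$ be the root of $g(x)=\delta$, where $$g(x)=\Phi\!\left(\frac{x}{2}-\frac{\varepsilon}{x}\right)-e^{\varepsilon}\,\Phi\!\left(-\frac{x}{2}-\frac{\varepsilon}{x}\right),\qquad x>0.$$ Let $U_1\in\mathbb{R}^{m\times m}$, $U_2\in\mathbb{R}^{n\times n}$ be invertible matrices with $U_kU_k^\top=\Sigma_k$, $k=1,2$. Then the mechanism $K(X)=f(X)+Z$ with $Z\sim\mathcal{MN}_{m,n}(\mathbf{0},\Sigma_1,\Sigma_2)$ is $(\varepsilon,\delta)$-differentially private if and only if $$\sigma_m(U_1)\,\sigma_n(U_2)\ \ge\ \frac{s_2(f)}{B}.$$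
   Context: $\Phi$ is the cumulative distribution function of the standard normal distribution. $\|\cdot\|_F$ is the Frobenius norm. For a matrix $A\in\mathbb{R}^{n\times n}$, $\sigma_1(A)\ge\cdots\ge\sigma_n(A)$ are its singular values in non-increasing order. $\mathbb{X}$ is the set of datasets; $X\simeq X'$ (adjacent, $d(X,X')=1$) means that the datasets $X,X'$ differ by a single record. The $\ell_2$-sensitivity of $f$ is $s_2(f)=\sup_{d(X,X')=1}\|f(X)-f(X')\|_F$. Matrix Gaussian distribution: $Z\sim\mathcal{MN}_{m,n}(M,\Sigma_1,\Sigma_2)$, with $\Sigma_k=U_kU_k^\top$ and $U_k$ invertible, means that $Z$ is an $m\times n$ random matrix with density proportional to $\exp\{-\tfrac12\|U_1^{-1}(z-M)U_2^{-\top}\|_F^2\}$; equivalently $U_1^{-1}(Z-M)U_2^{-\top}$ has i.i.d. $\mathcal{N}(0,1)$ entries. A randomized mechanism $K$ is $(\varepsilon,\delta)$-differentially private if for all adjacent $X\simeq X'$ and all (measurable) output sets $\mathcal{O}$, $\Pr(K(X)\in\mathcal{O})\le e^{\varepsilon}\Pr(K(X')\in\mathcal{O})+\delta$. The function $g$ is monotonically increasing on $(0,\infty)$ with range $(0,1)$, so the root $B$ exists.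
   Formalization: For one fixed f the ''only if'' part is false, since the differences of f may avoid the worst direction; so privacy of K(X)=f(X)+Z is replaced by privacy of h(X)+Z for every query h with s_2(h)=s_2(f). *)

(* Defs.v *)
From HB Require Import structures.
From mathcomp Require Import all_boot all_order all_algebra.
From mathcomp Require polyrcf.
From mathcomp Require Import all_classical all_reals all_analysis.

Set Implicit Arguments.
Unset Strict Implicit.
Unset Printing Implicit Defensive.

Import Order.TTheory GRing.Theory Num.Theory.
Import numFieldNormedType.Exports.

Local Open Scope classical_set_scope.
Local Open Scope ring_scope.

Definition frobenius_norm (R : realType) (m n : nat) (A : 'M[R]_(m, n)) : R :=
  Num.sqrt (\sum_(i < m) \sum_(j < n) A i j ^+ 2).

(* The square roots of the eigenvalues of A^T A, in non-increasing order.
   Each eigenvalue is repeated according to its multiplicity as a root of the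
   characteristic polynomial; as A^T A is symmetric positive semidefinite, all
   the roots are real and nonnegative, and the list has length n. *)
Definition singular_values (R : realType) (n : nat) (A : 'M[R]_n) : seq R :=
  let p := char_poly (A^T *m A) in
  sort >=%R (flatten [seq nseq (mup x p) (Num.sqrt x) | x <- polyrcf.rootsR p]).

(* The k-th singular value, 1 <= k <= n, counted from 1. *)
Definition sigma (R : realType) (n : nat) (k : nat) (A : 'M[R]_n) : R :=
  nth 0 (singular_values A) k.-1.

Definition Phi (R : realType) (x : R) : R :=
  fine (normal_prob 0 1 `]-oo, x]).

Definition g (R : realType) (eps x : R) : R :=
  Phi (x / 2 - eps / x) - expR eps * Phi (- (x / 2) - eps / x).

(* The Borel sets of the m x n matrices, as the product sigma-algebra generated
   by the entries (the convention of the library for n.-tuple). *)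
Definition measurable_mx (R : realType) (m n : nat) :
    set (set 'M[R]_(m, n)) :=
  <<s [set A : set 'M[R]_(m, n) | exists i j (B : set R),
        measurable B /\ A = [set M : 'M[R]_(m, n) | B (M i j)]] >>.

(* The entries of W are i.i.d. standard normal. The product rule over
   subfamilies of the entries is obtained by taking B i j = setT elsewhere. *)
Definition iid_std_normal (R : realType) (d : measure_display)
    (T : measurableType d) (P : probability T R) (m n : nat)
    (W : T -> 'M[R]_(m, n)) : Prop :=
  [/\ forall i j, measurable_fun [set: T] (fun w => W w i j),
      forall i j (B : set R), measurable B ->
        P [set w | B (W w i j)] = normal_prob 0 1 B
    & forall B : 'I_m -> 'I_n -> set R, (forall i j, measurable (B i j)) ->
        P [set w | forall i j, B i j (W w i j)] =
        (\prod_(i < m) \prod_(j < n) P [set w | B i j (W w i j)])%E].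

(* Z ~ MN_{m,n}(M, S1, S2). The law does not depend on the factors U1, U2 of
   S1, S2: they are determined up to right multiplication by orthogonal
   matrices, under which i.i.d. standard normal entries are invariant. *)
Definition matrix_normal (R : realType) (d : measure_display)
    (T : measurableType d) (P : probability T R) (m n : nat)
    (Z : T -> 'M[R]_(m, n)) (M : 'M[R]_(m, n))
    (S1 : 'M[R]_m) (S2 : 'M[R]_n) : Prop :=
  exists (U1 : 'M[R]_m) (U2 : 'M[R]_n),
    [/\ U1 \in unitmx, U2 \in unitmx, U1 *m U1^T = S1, U2 *m U2^T = S2
      & iid_std_normal P (fun w => invmx U1 *m (Z w - M) *m (invmx U2)^T)].

(* dist x x' counts the records on which the datasets x and x' differ. *)
Definition adjacent_datasets (X : Type) (dist : X -> X -> nat) (x x' : X) : Prop :=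
  dist x x' = 1%N.

(* Extended-real valued: +oo when the differences are unbounded, and -oo when
   there are no adjacent datasets. *)
Definition sensitivity (R : realType) (X : Type) (dist : X -> X -> nat)
    (m n : nat) (f : X -> 'M[R]_(m, n)) : \bar R :=
  ereal_sup [set s | exists x x', adjacent_datasets dist x x' /\
                       s = (frobenius_norm (f x - f x'))%:E].

Definition differentially_private (R : realType) (d : measure_display)
    (T : measurableType d) (P : probability T R)
    (X : Type) (dist : X -> X -> nat) (m n : nat) (eps delta : R)
    (K : X -> T -> 'M[R]_(m, n)) : Prop :=
  forall x x', adjacent_datasets dist x x' ->
  forall O : set 'M[R]_(m, n), measurable_mx O ->
    (P (K x @^-1` O) <= (expR eps)%:E * P (K x' @^-1` O) + delta%:E)%E.

Definition additive_mechanism (R : realType) (T X : Type) (m n : nat)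
    (f : X -> 'M[R]_(m, n)) (Z : T -> 'M[R]_(m, n)) (x : X) (w : T) :
    'M[R]_(m, n) :=
  f x + Z w.

(* Main.v *)
(* After whitening, the outputs on two adjacent datasets are W and W + D with W
   a matrix of i.i.d. standard normal entries.  The law mu of W satisfies the
   Cameron-Martin formula E F(W + D) = E[F(W) exp(<D, W> - |D|^2 / 2)], which
   is proved one entry at a time.  By Neyman-Pearson, the excess
   P(W + D in O) - e^eps P(W in O) is then maximal on a half-space
   {<D, M> >= c}, where it equals g(|D|).  Since g'(x) = phi(x/2 - eps/x) > 0,
   the privacy condition for the pair reads |D| <= B.  Finally
   |U1^-1 A U2^-T| <= |A| / (sigma_m(U1) sigma_n(U2)), with equality for some
   A; for necessity, a Householder reflection applied to f turns any given
   difference f x - f x' into that worst direction without changing the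
   sensitivity. *)
From HB Require Import structures.
Require Import Defs.
From mathcomp Require Import all_boot all_order all_algebra.
From mathcomp Require Import all_classical all_reals all_analysis.
From mathcomp Require Import measurable_realfun ring lra.
From mathcomp Require polyrcf complex spectral.

Set Implicit Arguments.
Unset Strict Implicit.
Unset Printing Implicit Defensive.

Import Order.TTheory GRing.Theory Num.Theory.
Import numFieldNormedType.Exports.
Local Open Scope classical_set_scope.
Local Open Scope ring_scope.

(** * Densities and translations *)

Section density.
Local Open Scope ereal_scope.
Context d (T : measurableType d) (R : realType).
Variables (mu nu : {measure set T -> \bar R}) (f : T -> R).
Hypothesis mf : measurable_fun [set: T] f.
Hypothesis f0 : forall x, (0 <= f x)%R.
Hypothesis nuE : forall A, measurable A -> nu A = \int[mu]_(x in A) (f x)%:E.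

Import HBNNSimple.

(** Monotone convergence along increasing simple functions, on both sides, reduces the claim to
    indicators, where it is [nuE]. *)
Lemma integral_density (F : T -> \bar R) : measurable_fun [set: T] F ->
  (forall x, 0 <= F x) -> \int[nu]_x F x = \int[mu]_x (F x * (f x)%:E).
Proof.
move=> mF F0.
pose h := nnsfun_approx measurableT mF.
have mEf : measurable_fun [set: T] (EFin \o f) by exact/measurable_EFinP.
have Fh x : F x = lim ((h n x)%:E @[n --> \oo]).
  by apply/esym/cvg_lim => //; exact: cvg_nnsfun_approx.
transitivity (lim (\int[nu]_x (h n x)%:E @[n --> \oo])).
  under eq_integral do rewrite Fh.
  apply: monotone_convergence => //.
  - by move=> n; apply/measurable_EFinP.
  - by move=> n x _; rewrite lee_fin.
  - by move=> x _ a b ab; rewrite lee_fin; exact/lefP/nd_nnsfun_approx.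
transitivity (lim (\int[mu]_x ((h n x)%:E * (f x)%:E) @[n --> \oo])); last first.
  have Ff x : F x * (f x)%:E = lim (((h n x)%:E * (f x)%:E) @[n --> \oo]).
    by apply/esym/cvg_lim => //; apply: cvgeZr => //; exact: cvg_nnsfun_approx.
  under [RHS]eq_integral do rewrite Ff.
  apply/esym; apply: monotone_convergence => //.
  - by move=> n; apply: emeasurable_funM => //; exact/measurable_EFinP.
  - by move=> n x _; rewrite mule_ge0// lee_fin.
  - by move=> x _ a b ab; rewrite lee_wpmul2r ?lee_fin//; exact/lefP/nd_nnsfun_approx.
apply: congr_lim; apply/funext => n.
transitivity (\int[nu]_x
   (\sum_(y \in range (h n)) (y * \1_(h n @^-1` [set y]) x)%:E)).
  by apply: eq_integral => t _; rewrite /= fimfunE -fsumEFin.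
rewrite ge0_integral_fsum//; first last.
- by move=> m y _; exact: nnfun_muleindic_ge0.
- by move=> r; apply/measurable_EFinP; exact: measurable_funM.
transitivity (\int[mu]_x
    (\sum_(y \in range (h n)) (y * \1_(h n @^-1` [set y]) x)%:E * (f x)%:E)); last first.
  apply: eq_integral => x _; rewrite -ge0_mule_fsuml => [|y]; last exact: nnfun_muleindic_ge0.
  by rewrite fsumEFin// -(fimfunE _ x).
rewrite ge0_integral_fsum//; first last.
- by move=> m y _; rewrite mule_ge0 ?lee_fin// -lee_fin nnfun_muleindic_ge0.
- move=> r; apply: emeasurable_funM => //.
  by apply/measurable_EFinP; exact: measurable_funM.
apply: eq_fsbigr => r rhn.
rewrite integralZl_indic_nnsfun// integral_indic// setIT nuE//.
under [RHS]eq_integral do rewrite EFinM -muleA.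
rewrite ge0_integralZl//; first last.
- by move: rhn; rewrite inE => -[t _ <-]; rewrite lee_fin.
- by move=> x _; rewrite mule_ge0// lee_fin.
- by apply: emeasurable_funM => //; exact/measurable_EFinP.
congr (_ * _).
rewrite integral_mkcond/=; apply: eq_integral => x _.
by rewrite epatch_indic muleC.
Qed.

End density.

(** Packages the integral as a measure, so that uniqueness of measures applies to tilted and
    restricted laws. *)
Lemma density_measure d (T : measurableType d) (R : realType)
    (mu : {measure set T -> \bar R}) (f : T -> R) :
  measurable_fun [set: T] f -> (forall x, 0 <= f x) ->
  exists nu : {measure set T -> \bar R},
    forall A, nu A = (\int[mu]_(x in A) (f x)%:E)%E.
Proof.
move=> mf f0; pose m (A : set T) := (\int[mu]_(x in A) (f x)%:E)%E.
have m0 : m set0 = 0%E by rewrite /m integral_set0.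
have mge0 A : (0 <= m A)%E by apply: integral_ge0 => x _; rewrite lee_fin.
have madd : semi_sigma_additive m.
  move=> F mF tF mUF; rewrite /m ge0_integral_bigcup//=; last 2 first.
    by apply/measurable_EFinP; exact: measurable_funTS.
    by move=> x _; rewrite lee_fin.
  by apply: is_cvg_ereal_nneg_natsum_cond => n _ _; exact: mge0.
pose mm := isMeasure.Build _ _ _ m m0 mge0 madd.
pose nu : {measure set T -> \bar R} := HB.pack m mm.
by exists nu.
Qed.

(** Lebesgue measure is determined by its values on half-open intervals, whose lengths a translation
    preserves. *)
Lemma lebesgue_measureD (R : realType) (a : R) (A : set R) : measurable A ->
  pushforward lebesgue_measure ((fun x => x + a) : _ -> measurableTypeR R) A =
  lebesgue_measure A.
Proof.
move=> mA; apply/esym/lebesgue_measure_unique => //=.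
  exact: measurable_funD.
move=> _ _ [[b c]] _ <-.
rewrite /pushforward /= (_ : _ @^-1` _ = `]b - a, c - a]%classic).
  rewrite !lebesgue_measure_itv/= !lte_fin.
  rewrite ltrD2r; case: ifP => // _; rewrite -!EFinB; congr EFin; ring.
by apply/seteqP; split=> x /=; rewrite !in_itv/= ltrBlDr lerBrDr.
Qed.

Lemma integral_shift (R : realType) (a : R) (f : R -> \bar R) :
  measurable_fun [set: R] f -> (forall x, 0 <= f x)%E ->
  (\int[lebesgue_measure]_x f (x + a)%R = \int[lebesgue_measure]_x f x)%E.
Proof.
move=> mf f0.
have ms : measurable_fun [set: R] ((fun x => x + a) : R -> measurableTypeR R).
  exact: measurable_funD.
transitivity (\int[pushforward lebesgue_measure
   ((fun x => x + a)%R : _ -> measurableTypeR R)]_x f x)%E.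
  by rewrite ge0_integral_pushforward.
by apply: eq_measure_integral => A mA _; exact: lebesgue_measureD.
Qed.
(** * Monotonicity of the privacy profile *)

Section gaussian_profile.
Variable R : realType.
Local Notation phi := (normal_pdf (0 : R) 1).

Lemma is_derive_Phi (x : R) : is_derive x 1 (@Phi R) (phi x).
Proof.
(* [x + 1] only serves as an endpoint beyond [x]. *)
have [] := @continuous_FTC1 R phi -oo%O x (x + 1).
- by rewrite ltrDl.
- by apply: (integrableS _ _ (subsetT _)) => //; exact: integrable_normal_pdf.
- by rewrite ltNyr.
- exact: continuous_normal_pdf (oner_neq0 _) x.
by move=> dP <-; rewrite derive1E; exact/derivableP.
Qed.

Lemma normal_pdf_std (x : R) : phi x = normal_peak 1 * expR (- x ^+ 2 / 2).
Proof. by rewrite normal_pdfE ?oner_neq0// /normal_fun subr0 expr1n. Qed.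

(** Completing the square: the exponential is the likelihood ratio of N(c, 1) to N(0, 1). *)
Lemma normal_pdf_shift (c x : R) :
  phi x * expR (c * x - c ^+ 2 / 2) = phi (x - c).
Proof.
rewrite !normal_pdf_std -mulrA -expRD; congr (_ * expR _).
by field.
Qed.

Lemma normal_pdf_std_gt0 (x : R) : 0 < phi x.
Proof. by rewrite normal_pdf_std mulr_gt0 ?expR_gt0 ?normal_peak_gt0 ?oner_neq0. Qed.

(** The inner derivatives are 1/2 + eps/x^2 and -1/2 + eps/x^2. Once both terms carry the same
    density, the parts in eps cancel and the halves add up to 1. *)
Lemma is_derive_g (eps x : R) : 0 < x ->
  is_derive x 1 (g eps) (phi (x / 2 - eps / x)).
Proof.
move=> x0; have xn0 : x != 0 by rewrite gt_eqF.
have dV : is_derive x 1 (fun y : R => y^-1) (- x ^- 2).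
  have := @is_deriveV R id x 1 1 xn0 (is_derive_id x 1).
  by rewrite /GRing.scale/= mulr1.
have d1 : is_derive x 1 (fun y : R => y / 2 - eps / y) (2^-1 + eps * x ^- 2).
  apply: is_derive_eq; rewrite /GRing.scale/=; field => //.
have d2 : is_derive x 1 (fun y : R => - (y / 2) - eps / y) (- 2^-1 + eps * x ^- 2).
  apply: is_derive_eq; rewrite /GRing.scale/=; field => //.
have D1 := @is_derive1_comp R _ _ x _ _ (is_derive_Phi _) d1.
have D2 := @is_derive1_comp R _ _ x _ _ (is_derive_Phi _) d2.
have : is_derive x 1 ((@Phi R \o (fun y : R => y / 2 - eps / y)) -
    expR eps *: (@Phi R \o (fun y : R => - (y / 2) - eps / y)))
    (phi (x / 2 - eps / x)).
  apply: is_derive_eq; rewrite /GRing.scale/=.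
  (* e^eps phi(x/2 + eps/x) = phi(x/2 - eps/x), as the squares differ by 2 eps *)
  have -> : expR eps *
      (phi (- (x / 2) - eps / x) * (- 2^-1 + eps * x ^- 2)) =
      phi (x / 2 - eps / x) * (- 2^-1 + eps * x ^- 2).
    rewrite mulrA; congr (_ * _); rewrite !normal_pdf_std mulrCA -expRD.
    by congr (_ * expR _); field.
  by field.
by [].
Qed.

Lemma g_increasing (eps x y : R) : 0 < x -> x < y -> g eps x < g eps y.
Proof.
move=> x0 xy.
have dg z : 0 < z -> derivable (g eps) z 1.
  by move=> /(is_derive_g eps) [].
have pos z : x <= z -> 0 < z by exact: lt_le_trans.
apply: (@gtr0_derive1_lt_cc R (g eps) x y) => //.
- by move=> z; rewrite in_itv/= => /andP[/ltW/pos/dg].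
- move=> z; rewrite in_itv/= => /andP[/ltW/pos z0 _].
  by rewrite derive1E; have [_ ->] := is_derive_g eps z0; exact: normal_pdf_std_gt0.
- apply: derivable_within_continuous => z.
  by rewrite in_itv/= => /andP[/pos/dg].
- by rewrite in_itv/= lexx ltW.
- by rewrite in_itv/= lexx ltW.
Qed.

End gaussian_profile.
(** * The Frobenius inner product and singular values *)

(** On the diagonal this is convertible to the radicand of [frobenius_norm]. *)
Definition mxdot (R : realType) m n (A B : 'M[R]_(m, n)) : R :=
  \sum_i \sum_j A i j * B i j.

Section mxdot.
Variable R : realType.

Lemma mxdotE m n (A B : 'M[R]_(m, n)) : mxdot A B = \tr (A^T *m B).
Proof.
rewrite /mxdot exchange_big /mxtrace; apply: eq_bigr => j _.
by rewrite mxE; apply: eq_bigr => i _; rewrite mxE.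
Qed.

Lemma mxdotC m n (A B : 'M[R]_(m, n)) : mxdot A B = mxdot B A.
Proof. by apply: eq_bigr => i _; apply: eq_bigr => j _; rewrite mulrC. Qed.

Lemma mxdotDl m n (A B C : 'M[R]_(m, n)) :
  mxdot (A + B) C = mxdot A C + mxdot B C.
Proof. by rewrite !mxdotE linearD/= mulmxDl linearD. Qed.

Lemma mxdotZl m n a (A C : 'M[R]_(m, n)) : mxdot (a *: A) C = a * mxdot A C.
Proof. by rewrite !mxdotE linearZ/= -scalemxAl linearZ. Qed.

Lemma mxdotDr m n (A B C : 'M[R]_(m, n)) :
  mxdot C (A + B) = mxdot C A + mxdot C B.
Proof. by rewrite mxdotC mxdotDl !(mxdotC C). Qed.

Lemma mxdotZr m n a (A C : 'M[R]_(m, n)) : mxdot C (a *: A) = a * mxdot C A.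
Proof. by rewrite mxdotC mxdotZl (mxdotC C). Qed.

Lemma mxdot_tr m n (A B : 'M[R]_(m, n)) : mxdot A^T B^T = mxdot A B.
Proof. by rewrite !mxdotE trmxK mxtrace_mulC -mxtrace_tr trmx_mul trmxK. Qed.

Lemma mxdot_mull m n p (U : 'M[R]_(p, m)) (A : 'M[R]_(m, n)) (B : 'M[R]_(p, n)) :
  mxdot (U *m A) B = mxdot A (U^T *m B).
Proof. by rewrite !mxdotE trmx_mul mulmxA. Qed.

Lemma mxdot_ge0 m n (A : 'M[R]_(m, n)) : 0 <= mxdot A A.
Proof. by apply: sumr_ge0 => i _; apply: sumr_ge0 => j _; rewrite -expr2 sqr_ge0. Qed.

Lemma mxdot_eq0 m n (A : 'M[R]_(m, n)) : (mxdot A A == 0) = (A == 0).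
Proof.
apply/eqP/eqP => [A0|->]; last first.
  by apply: big1 => i _; apply: big1 => j _; rewrite !mxE mul0r.
apply/matrixP => i j; rewrite mxE; apply/eqP; rewrite -sqrf_eq0 expr2.
have h k : 0 <= \sum_j A k j * A k j.
  by apply: sumr_ge0 => l _; rewrite -expr2 sqr_ge0.
have /(_ i isT)/eqP := psumr_eq0P (fun k _ => h k) A0.
rewrite psumr_eq0 => [/allP/(_ j)|l _]; last by rewrite -expr2 sqr_ge0.
by rewrite mem_index_enum => /(_ isT).
Qed.

Lemma frobenius_normE m n (A : 'M[R]_(m, n)) :
  frobenius_norm A = Num.sqrt (mxdot A A).
Proof. by []. Qed.

Lemma frobenius_norm_sqr m n (A : 'M[R]_(m, n)) :
  frobenius_norm A ^+ 2 = mxdot A A.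
Proof. by rewrite sqr_sqrtr// mxdot_ge0. Qed.

Lemma frobenius_norm_ge0 m n (A : 'M[R]_(m, n)) : 0 <= frobenius_norm A.
Proof. exact: sqrtr_ge0. Qed.

Lemma frobenius_normZ m n c (A : 'M[R]_(m, n)) :
  frobenius_norm (c *: A) = `|c| * frobenius_norm A.
Proof.
by rewrite !frobenius_normE mxdotZl mxdotZr mulrA -expr2 sqrtrM ?sqr_ge0// sqrtr_sqr.
Qed.

(** Extends norm bounds for [U *m v] from column vectors to matrices. *)
Lemma mxdot_col m n (A : 'M[R]_(m, n)) :
  mxdot A A = \sum_j mxdot (col j A) (col j A).
Proof.
rewrite /mxdot exchange_big; apply: eq_bigr => j _; apply: eq_bigr => i _.
by rewrite big_ord1 !mxE.
Qed.

End mxdot.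

(** * Singular values through the spectral theorem *)

Section singular_values.
Import polyrcf complex spectral.
Local Open Scope complex_scope.
Local Open Scope sesquilinear_scope.
Variable R : realType.

Lemma conj_real_complex (x : R) : Num.conj (x%:C : R[i]) = x%:C.
Proof. by apply: conj_Creal; apply/complex_realP; exists x. Qed.

(* The spectral theorem of the library is over an algebraically closed field,
   hence the passage to R[i]. *)
Lemma sym_spectral n (S : 'M[R]_n) : S^T = S ->
  exists (r : 'I_n -> R) (P : 'M[R[i]]_n),
    [/\ P \is unitarymx, char_poly S = \prod_i ('X - (r i)%:P) &
     map_mx (real_complex R) S = invmx P *m diag_mx (\row_i (r i)%:C) *m P].
Proof.
move=> symS.
set A := map_mx (real_complex R) S.
have hA : A \is hermsymmx.
  apply/is_hermitianmxP; rewrite expr0 scale1r.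
  by apply/matrixP => i j; rewrite !mxE -[in LHS]symS mxE conj_real_complex.
have /orthomx_spectralP eA := hermitian_normalmx hA.
have rD := hermitian_spectral_diag_real hA.
have uP := spectral_unitarymx A.
set P := spectralmx A in eA uP *; set D := spectral_diag A in eA rD *.
pose r i := complex.Re (D 0 i).
have Dr : D = \row_i (r i)%:C.
  apply/rowP => i; rewrite mxE /r.
  by have /mxOverP/(_ 0 i)/complex_realP[x ->] := rD.
exists r, P; rewrite -Dr; split; [exact: uP| |exact: eA].
(* It is enough to compare the two real polynomials over R[i], where [A] is similar to a diagonal
   matrix. *)
apply: (map_poly_inj (real_complex R)); rewrite map_char_poly -/A.
have -> : char_poly A = char_poly (diag_mx D).
  rewrite /char_poly; pose Q := map_mx polyC P.
  have QV : map_mx polyC (invmx P) *m Q = 1%:M.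
    by rewrite -map_mxM mulVmx ?map_mx1 ?unitarymx_unit.
  have -> : char_poly_mx A = map_mx polyC (invmx P) *m char_poly_mx (diag_mx D) *m Q.
    rewrite /char_poly_mx mulmxBr mulmxBl -!map_mxM -eA.
    by rewrite scalar_mxC -mulmxA QV mulmx1.
  by rewrite !det_mulmx mulrAC -det_mulmx QV det1 mul1r.
rewrite char_poly_trig ?diag_mx_is_trig// rmorph_prod/=; apply: eq_bigr => i _.
by rewrite Dr !mxE eqxx mulr1n rmorphB/= map_polyX map_polyC.
Qed.

Lemma rayleigh n (S : 'M[R]_n) (P : 'M[R[i]]_n) (r : 'I_n -> R) (v : 'cV[R]_n) :
  P \is unitarymx ->
  map_mx (real_complex R) S = invmx P *m diag_mx (\row_i (r i)%:C) *m P ->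
  ((v^T *m S *m v) 0 0)%:C =
  \sum_i (r i)%:C * `|(P *m map_mx (real_complex R) v) i 0| ^+ 2.
Proof.
move=> uP eS; set w := P *m _.
have -> : ((v^T *m S *m v) 0 0)%:C = (map_mx (real_complex R) (v^T *m S *m v)) 0 0.
  by rewrite [RHS]mxE.
rewrite !map_mxM/= eS !mulmxA -mulmxA -/w.
(* As [v] is real, its transpose is its adjoint, and the inverse of the unitary [P] is the adjoint
   of [P]. *)
have -> : map_mx (real_complex R) v^T *m invmx P = w ^t*.
  rewrite invmx_unitary// /w trmx_mul map_mxM/=; congr (_ *m _).
  by apply/matrixP => i j; rewrite !mxE conj_real_complex.
rewrite -mulmxA mxE; apply: eq_bigr => i _.
rewrite mul_diag_mx !mxE mulrCA; congr (_ * _).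
by rewrite normCK mulrC.
Qed.

Lemma rayleigh_lower n (S : 'M[R]_n) (P : 'M[R[i]]_n) (r : 'I_n -> R) (c : R) (v : 'cV[R]_n) :
  P \is unitarymx ->
  map_mx (real_complex R) S = invmx P *m diag_mx (\row_i (r i)%:C) *m P ->
  (forall i, c <= r i) -> c * mxdot v v <= mxdot v (S *m v).
Proof.
move=> uP eS cr.
have tr11 (M : 'M[R]_1) : \tr M = M 0 0 by rewrite /mxtrace big_ord1.
(* The scalar matrix is diagonalised by the same [P], so the two quadratic forms compare term by
   term. *)
have eC : map_mx (real_complex R) (c%:M : 'M[R]_n) =
    invmx P *m diag_mx (\row_i (c%:C)) *m P.
  have -> : diag_mx (\row_(i < n) c%:C) = (c%:C)%:M.
    by apply/matrixP => i j; rewrite !mxE.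
  by rewrite scalar_mxC -mulmxA mulVmx ?unitarymx_unit// mulmx1 map_scalar_mx.
rewrite !mxdotE !tr11 mulmxA.
have -> : c * (v^T *m v) 0 0 = (v^T *m c%:M *m v) 0 0.
  by rewrite mul_mx_scalar -scalemxAl [RHS]mxE.
have H : ((v^T *m c%:M *m v) 0 0)%:C <= ((v^T *m S *m v) 0 0)%:C.
  rewrite (rayleigh _ uP eC) (rayleigh _ uP eS); apply: ler_sum => i _.
  by rewrite ler_wpM2r ?exprn_ge0// lecR.
by rewrite lecR in H.
Qed.

(** [rootsR] lists each root once, and its multiplicity in a split polynomial is its number of
    occurrences among the [r i]. *)
Lemma singular_values_perm n (A : 'M[R]_n) (r : 'I_n -> R) :
  char_poly (A^T *m A) = \prod_i ('X - (r i)%:P) ->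
  perm_eq (singular_values A) [seq Num.sqrt (r i) | i <- enum 'I_n].
Proof.
move=> ep; pose s := [seq r i | i <- enum 'I_n].
apply: (perm_trans (permEl (perm_sort _ _))).
set p := char_poly _.
have ps : p = \prod_(x <- s) ('X - x%:P) by rewrite big_map enumT.
have p0 : p != 0 by rewrite monic_neq0// char_poly_monic.
have mp x : mup x p = count_mem x s by rewrite ps mu_prod_XsubC.
have -> : flatten [seq nseq (mup x p) (Num.sqrt x) | x <- rootsR p] =
  map Num.sqrt (flatten [seq nseq (count_mem x s) x | x <- rootsR p]).
  rewrite map_flatten -map_comp; congr flatten; apply: eq_map => x /=.
  by rewrite map_nseq mp.
have -> : [seq Num.sqrt (r i) | i <- enum 'I_n] = map Num.sqrt s.
  exact: (map_comp Num.sqrt r).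
apply: perm_map; apply: perm_trans (perm_count_undup s).
apply/perm_flatten/perm_map/uniq_perm; rewrite ?undup_uniq ?uniq_roots//.
move=> x; rewrite mem_undup -[RHS]root_prod_XsubC -ps.
by rewrite -(roots_on_rootsR p0) in_itv.
Qed.

(** The list is non-increasing of length n, so its least value sits at index [n.-1]. As n > 0 this
    index is in range, and the default 0 of [nth] is not read. *)
Lemma sigma_last n (A : 'M[R]_n) (r : 'I_n -> R) : (0 < n)%N ->
  char_poly (A^T *m A) = \prod_i ('X - (r i)%:P) ->
  (exists i, sigma n A = Num.sqrt (r i)) /\ forall i, sigma n A <= Num.sqrt (r i).
Proof.
move=> n0 /singular_values_perm pe.
have sz : size (singular_values A) = n.
  by rewrite (perm_size pe) size_map size_enum_ord.
have lt1 : (n.-1 < size (singular_values A))%N by rewrite sz prednK.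
split.
  have : sigma n A \in singular_values A by rewrite mem_nth.
  by rewrite (perm_mem pe) => /mapP[i _ ->]; exists i.
move=> i; have : Num.sqrt (r i) \in singular_values A.
  by rewrite (perm_mem pe); apply/mapP; exists i; rewrite ?mem_enum.
move=> /(nthP 0)[k]; rewrite sz => kn <-.
have srt : sorted >=%R (singular_values A).
  by apply: sort_sorted => x y; rewrite orbC le_total.
apply: (sorted_leq_nth (rev_trans le_trans) (@lexx _ R) 0 srt).
- by rewrite inE sz.
- by rewrite inE.
- by rewrite -ltnS prednK.
Qed.

(** The square of the last singular value is the least eigenvalue of [A^T *m A]: it bounds the
    Rayleigh quotient from below, with equality at an eigenvector. Injectivity of [A] makes it
    positive. *)
Lemma sigma_min n (A : 'M[R]_n) : (0 < n)%N -> A \in unitmx ->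
  [/\ 0 < sigma n A,
      forall v : 'cV[R]_n, sigma n A ^+ 2 * mxdot v v <= mxdot (A *m v) (A *m v)
    & exists2 v : 'cV[R]_n, v != 0 & mxdot (A *m v) (A *m v) = sigma n A ^+ 2 * mxdot v v].
Proof.
move=> n0 uA; set S := A^T *m A.
have symS : S^T = S by rewrite trmx_mul trmxK.
have [r [P [uP cp eS]]] := sym_spectral symS.
have [[i0 s0] sle] := sigma_last n0 cp.
have eig i : exists2 v : 'cV[R]_n, v != 0 & mxdot (A *m v) (A *m v) = r i * mxdot v v.
  have : eigenvalue S (r i).
    rewrite eigenvalue_root_char cp; apply/rootP.
    by rewrite horner_prod (bigD1 i)//= !hornerE subrr mul0r.
  (* [eigenvalueP] yields a row eigenvector; by symmetry of [S] its transpose is a column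
     eigenvector. *)
  move=> /eigenvalueP[u uS u0]; exists u^T; first by rewrite trmx_eq0.
  rewrite mxdot_mull mulmxA -/S -symS -trmx_mul uS.
  by rewrite linearZ/= mxdotZr.
have r_gt0 i : 0 < r i.
  have [v v0 e] := eig i.
  have vv : 0 < mxdot v v by rewrite lt_def mxdot_eq0 v0 mxdot_ge0.
  rewrite -(pmulr_lgt0 _ vv) -e lt_def mxdot_ge0 andbT mxdot_eq0.
  by apply: contra v0 => /eqP Av; rewrite -(mulKmx uA v) Av mulmx0.
have s2 : sigma n A ^+ 2 = r i0 by rewrite s0 sqr_sqrtr// ltW.
split.
- by rewrite s0 sqrtr_gt0.
- move=> v; rewrite mxdot_mull mulmxA; apply: (rayleigh_lower _ uP eS) => i.
  rewrite s2; have := sle i; rewrite s0.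
  by rewrite ler_sqrt// ltW.
- by rewrite s2; exact: eig.
Qed.

End singular_values.
(** * The Cameron-Martin formula *)

Lemma integral_setI_indicE d (T : measurableType d) (R : realType)
    (mu : {measure set T -> \bar R}) (A : set T) (f : T -> \bar R) :
  (\int[mu]_(x in A) f x = \int[mu]_x (f x * (\1_A x)%:E))%E.
Proof.
by rewrite integral_mkcond; apply: eq_integral => x _; rewrite epatch_indic.
Qed.

(** The tilted density is phi(x - c), and translating Lebesgue measure by c moves the shift onto the
    set. *)
Lemma normal_prob_shift (R : realType) (c : R) (A : set R) : measurable A ->
  (\int[normal_prob 0 1]_x ((\1_A x)%:E * (expR (c * x - c ^+ 2 / 2))%:E) =
   normal_prob 0 1 [set x | A (x + c)%R])%E.
Proof.
move=> mA.
have mI : measurable_fun [set: R] (fun x => (\1_A x : R)%:E).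
  by apply/measurable_EFinP; exact: measurable_indic.
have me : measurable_fun [set: R] (fun x : R => (expR (c * x - c ^+ 2 / 2))%:E).
  apply/measurable_EFinP; apply: measurableT_comp => //.
  by apply: measurable_funB => //; exact: measurable_funM.
have mp k : measurable_fun [set: R] (fun x : R => (normal_pdf 0 1 (x - k))%:E).
  apply/measurable_EFinP; apply: measurableT_comp; first exact: measurable_normal_pdf.
  exact: measurable_funB.
rewrite (@integral_density _ _ _ lebesgue_measure _ (normal_pdf 0 1))//.
- rewrite /normal_prob [RHS]integral_setI_indicE.
  transitivity (\int[lebesgue_measure]_x
      (fun y => (\1_A y)%:E * (normal_pdf 0 1 (y - c))%:E) (x + c)%R)%E; last first.
    apply: eq_integral => x _; rewrite /= addrK muleC !indicE.
    by congr (_ * (_%:R)%:E)%E; apply/idP/idP; rewrite !inE.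
  rewrite (@integral_shift _ c (fun y => (\1_A y)%:E * (normal_pdf 0 1 (y - c))%:E)%E).
  + by apply: eq_integral => x _; rewrite -muleA -EFinM [(expR _ * _)%R]mulrC normal_pdf_shift.
  + exact: emeasurable_funM.
  + by move=> x; rewrite mule_ge0// lee_fin// normal_pdf_ge0.
- exact: measurable_normal_pdf.
- by move=> x; exact: normal_pdf_ge0.
- exact: emeasurable_funM.
Qed.

(** * The product sigma-algebra on matrices *)

Section matrix_measurable.
Variables (R : realType) (m n : nat).

(** The generators of [measurable_mx], named to make matrices a measurable type that can carry
    integrals. *)
Definition entry_sets : set (set 'M[R]_(m, n)) :=
  [set A | exists i j (B : set R),
    measurable B /\ A = [set M : 'M[R]_(m, n) | B (M i j)]].

Local Notation MX := (g_sigma_algebraType entry_sets).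

Lemma measurable_entry i j : measurable_fun [set: MX] (fun M : MX => M i j : R).
Proof.
move=> _ B mB; rewrite setTI; apply: sub_sigma_algebra.
by exists i, j, B.
Qed.

Lemma measurable_fun_mx d (T : measurableType d) (W : T -> MX) :
  (forall i j, measurable_fun [set: T] (fun w => W w i j)) ->
  measurable_fun [set: T] W.
Proof.
move=> mW; apply: (@measurability _ _ _ MX _ _ entry_sets) => //.
move=> _ [_ [i [j [B [mB ->]]]] <-].
exact: mW.
Qed.

Lemma measurable_addmx (D : 'M[R]_(m, n)) :
  measurable_fun [set: MX] (fun M : MX => (M + D : MX)).
Proof.
apply: measurable_fun_mx => i j.
under eq_fun do rewrite mxE.
by apply: measurable_funD => //; exact: measurable_entry.
Qed.

Lemma measurable_mxdot (D : 'M[R]_(m, n)) :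
  measurable_fun [set: MX] (fun M : MX => mxdot D M).
Proof.
rewrite /mxdot; apply: measurable_sum => i; apply: measurable_sum => j.
by apply: measurable_funM => //; exact: measurable_entry.
Qed.

Definition mx_rect (B : 'I_m -> 'I_n -> set R) : set MX :=
  [set M : MX | forall i j, B i j (M i j)].

Lemma measurable_rect B : (forall i j, measurable (B i j)) ->
  measurable (mx_rect B).
Proof.
move=> mB.
have -> : mx_rect B = \bigcap_(p in [set: 'I_m * 'I_n]) [set M : MX | B p.1 p.2 (M p.1 p.2)].
  apply/seteqP; split => [M BM p _|M BM i j]; first exact: BM.
  exact: (BM (i, j)).
apply: fin_bigcap_measurable => [|[i j] _]; first exact: finite_finset.
 rewrite -[X in measurable X]setTI.
exact: measurable_entry.
Qed.

(** Rectangles are stable under intersection, include the whole space and generate the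
    sigma-algebra. *)
Lemma mx_measure_unique (mu nu : {measure set MX -> \bar R}) :
  (mu setT < +oo)%E ->
  (forall B, (forall i j, measurable (B i j)) ->
     mu (mx_rect B) = nu (mx_rect B)) ->
  forall A, measurable A -> mu A = nu A.
Proof.
move=> muT munu A mA.
pose G : set (set MX) := [set C | exists2 B, (forall i j, measurable (B i j)) & C = mx_rect B].
have GT : G setT by exists (fun _ _ => setT) => //; apply/seteqP; split.
apply: (@g_sigma_algebra_measure_unique _ R MX G _ (fun=> setT)) => //.
- by move=> _ [B mB ->]; exact: measurable_rect.
- by rewrite bigcup_const.
- move=> _ _ [B mB ->] [C mC ->]; exists (fun i j => B i j `&` C i j).
    by move=> i j; exact: measurableI.
  apply/seteqP; split => [M [BM CM] i j|M BCM]; first by split; [exact: BM|exact: CM].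
  by split => i j; have [] := BCM i j.
- by move=> _ [B mB ->]; exact: munu.
have : entry_sets `<=` <<s G >>.
  move=> _ [i0 [j0 [B [mB ->]]]]; apply: sub_sigma_algebra.
  (* A generator is a rectangle with a single constrained side. *)
  exists (fun i j => if (i == i0) && (j == j0) then B else setT).
    by move=> i j; case: ifP.
  apply/seteqP; split => [M /= BM i j|M /(_ i0 j0)]; last by rewrite !eqxx.
  by case: ifP => // /andP[/eqP-> /eqP->].
by move=> sub; exact: (smallest_sub (smallest_sigma_algebra _ _) sub).
Qed.

End matrix_measurable.

(** * Shifts and projections of the Gaussian law *)

Section gaussian_matrix.
Variables (R : realType) (m n : nat).
Local Notation MX := (g_sigma_algebraType (@entry_sets R m n)).
Variable mu : probability MX R.
Hypothesis mu_rect : forall B : 'I_m -> 'I_n -> set R,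
  (forall i j, measurable (B i j)) ->
  mu (mx_rect B) = (\prod_(i < m) \prod_(j < n) normal_prob 0 1 (B i j))%E.

(** Taking [A] to be [setT] frees the entry [p] and leaves an event on the other entries. *)
Let swap (B : 'I_m -> 'I_n -> set R) (p : 'I_m * 'I_n) (A : set R) i j : set R :=
  if (i, j) == p then A else B i j.

Let measurable_swap B p A : (forall i j, measurable (B i j)) -> measurable A ->
  forall i j, measurable (swap B p A i j).
Proof. by move=> mB mA i j; rewrite /swap; case: ifP. Qed.

Let mu_swap B p A : (forall i j, measurable (B i j)) -> measurable A ->
  mu (mx_rect (swap B p A)) =
  (normal_prob 0 1 A * mu (mx_rect (swap B p setT)))%E.
Proof.
move=> mB mA.
rewrite !mu_rect; [|exact: measurable_swap..].
rewrite !pair_big/= (bigD1 p)//= [in RHS](bigD1 p)//=.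
have swp C : swap B p C p.1 p.2 = C by rewrite /swap -surjective_pairing eqxx.
rewrite !swp.
have -> : normal_prob (0 : R) 1 [set: R] = 1%E.
  exact: (@probability_setT _ _ _ (normal_prob 0 1 : probability _ R)).
rewrite mul1e; congr (_ * _)%E; apply: eq_bigr => q qp.
by rewrite /swap -surjective_pairing (negbTE qp).
Qed.

(* On rectangles, independence isolates the entry p, so that the formula reduces
   to normal_prob_shift. *)
Lemma cameron_martin_entry (p : 'I_m * 'I_n) (c : R) (F : MX -> \bar R) :
  measurable_fun [set: MX] F -> (forall M, 0 <= F M)%E ->
  (\int[mu]_M F (M + c *: delta_mx p.1 p.2)%R =
   \int[mu]_M (F M * (expR (c * M p.1 p.2 - c ^+ 2 / 2))%:E))%E.
Proof.
move=> mF F0.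
pose sh (M : MX) : MX := M + c *: delta_mx p.1 p.2.
have msh : measurable_fun [set: MX] sh by exact: measurable_addmx.
pose h (x : R) : R := expR (c * x - c ^+ 2 / 2).
have mh : measurable_fun [set: R] h.
  apply: measurableT_comp => //.
  by apply: measurable_funB => //; exact: measurable_funM.
pose co (M : MX) : measurableTypeR R := M p.1 p.2.
have mco : measurable_fun [set: MX] co by exact: measurable_entry.
have mhco : measurable_fun [set: MX] (h \o co) by exact: measurableT_comp.
have h0 x : 0 <= h x by exact: expR_ge0.
have [nu nuE] := density_measure mu mhco (fun M => h0 (co M)).
(* Both sides become integrals of [F], against the shifted law and the tilted law [nu]; these two
   measures are then compared on rectangles. *)
transitivity (\int[pushforward mu sh]_M F M)%E.
  by rewrite ge0_integral_pushforward//.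
transitivity (\int[nu]_M F M)%E; last first.
  by rewrite (integral_density mhco (fun M => h0 (co M)) (fun A _ => nuE A)).
apply: eq_measure_integral => A mA _.
apply: mx_measure_unique mA.
  apply: (@le_lt_trans _ _ 1%E); last exact: ltry.
  by apply: probability_le1; rewrite -[X in measurable X]setTI; exact: msh.
move=> B mB.
set B0 := B p.1 p.2.
have mB0 : measurable [set x | B0 (x + c)].
  rewrite -[X in measurable X]setTI; apply: measurable_funD => //; exact: mB.
have shE M i j : sh M i j = if (i, j) == p then M i j + c else M i j.
  rewrite !mxE [p in RHS]surjective_pairing xpair_eqE.
  by case: ifP => _; rewrite ?mulr1// mulr0 addr0.
transitivity (mu (mx_rect (swap B p [set x | B0 (x + c)]))).
  congr (mu _); apply/seteqP; split => M /= BM i j; have := BM i j;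
    by rewrite /swap shE; case: eqP => // ep; rewrite /B0 -ep.
rewrite mu_swap//.
pose E := mx_rect (swap B p setT).
have mE : measurable E by apply: measurable_rect; exact: measurable_swap.
have mIE : measurable_fun [set: MX] (\1_E : MX -> R) by exact: measurable_indic.
have IE0 M : 0 <= (\1_E M : R) by [].
(* [ka] is [mu] restricted to [E]. By independence its image under the entry [p] is the standard
   normal law scaled by [mu E]. *)
have [ka kaE] := density_measure mu mIE IE0.
have kaE' A' : measurable A' -> pushforward ka co A' = (normal_prob 0 1 A' * mu E)%E.
  move=> mA'; rewrite /pushforward kaE integral_indic//; last first.
    by rewrite -[X in measurable X]setTI; exact: mco.
  rewrite -mu_swap//; congr (mu _); apply/seteqP; split => M /=.
    move=> [EM AM] i j; have := EM i j; rewrite /swap; case: eqP => // ijp _.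
    by move: AM; rewrite /co -ijp.
  move=> H; split; last by have := H p.1 p.2; rewrite /swap -surjective_pairing eqxx.
  by move=> i j; have := H i j; rewrite /swap; case: eqP.
have fE : mu E \is a fin_num by exact: fin_num_measure.
have c0 : 0 <= fine (mu E) by exact: fine_ge0.
have mF1 : measurable_fun [set: R] (fun x => (\1_B0 x)%:E * (h x)%:E)%E.
  apply: emeasurable_funM; apply/measurable_EFinP => //.
  by apply: measurable_indic; exact: mB.
have F10 x : (0 <= (\1_B0 x)%:E * (h x)%:E)%E by rewrite mule_ge0// lee_fin.
rewrite -normal_prob_shift//; last exact: mB.
rewrite muleC -[mu E]fineK//.
rewrite -(@ge0_integral_mscale _ _ _ (normal_prob 0 1) _ _ (NngNum c0))//.
transitivity (\int[pushforward ka co]_x ((\1_B0 x)%:E * (h x)%:E))%E.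
  apply: eq_measure_integral => A' mA' _.
  apply: etrans (esym (kaE' _ mA')).
  by rewrite /mscale muleC; congr (_ * _)%E; exact: fineK.
rewrite ge0_integral_pushforward// preimage_setT.
rewrite (integral_density mIE IE0 (fun A _ => kaE A)); last 2 first.
- exact: measurableT_comp mF1 mco.
- by move=> M; exact: F10.
rewrite nuE [RHS]integral_setI_indicE; apply: eq_integral => M _ /=.
rewrite -!EFinM; congr EFin; rewrite [(\1_B0 _ * _)]mulrC -mulrA; congr (_ * _).
rewrite !indicE -natrM mulnb; congr ((nat_of_bool _)%:R); apply/andP/idP.
  rewrite !inE => -[B0M EM] i j; have := EM i j; rewrite /swap.
  by case: eqP => // ijp _; move: B0M; rewrite /B0 /co -ijp.
rewrite !inE => BM; split; first exact: BM.
by move=> i j; rewrite /swap; case: eqP => // _; exact: BM.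
Qed.

(** The induction generalises over [F], since each shift of an entry is absorbed into the
    integrand. *)
Lemma cameron_martin_seq (D : 'M[R]_(m, n)) (s : seq ('I_m * 'I_n))
    (F : MX -> \bar R) :
  uniq s -> measurable_fun [set: MX] F -> (forall M, 0 <= F M)%E ->
  (\int[mu]_M F (M + \sum_(p <- s) D p.1 p.2 *: delta_mx p.1 p.2)%R =
   \int[mu]_M (F M * (expR (\sum_(p <- s)
     (D p.1 p.2 * M p.1 p.2 - D p.1 p.2 ^+ 2 / 2)))%:E))%E.
Proof.
elim: s F => [|p s IH] F /=.
  move=> _ _ _; apply: eq_integral => M _.
  by rewrite !big_nil addr0 expR0 mule1.
move=> /andP[ps us] mF F0.
pose e (M : MX) : R :=
  expR (\sum_(q <- s) (D q.1 q.2 * M q.1 q.2 - D q.1 q.2 ^+ 2 / 2)).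
have me : measurable_fun [set: MX] (EFin \o e).
  apply/measurable_EFinP; apply: measurableT_comp => //.
  apply: measurable_sum => q; apply: measurable_funB => //.
  by apply: measurable_funM => //; exact: measurable_entry.
pose F1 (M : MX) : \bar R := F (M + D p.1 p.2 *: delta_mx p.1 p.2).
have mF1 : measurable_fun [set: MX] F1.
  by apply: (measurableT_comp mF); exact: measurable_addmx.
transitivity (\int[mu]_M F1 (M + \sum_(q <- s) D q.1 q.2 *: delta_mx q.1 q.2)%R)%E.
  by apply: eq_integral => M _; rewrite /F1 big_cons addrA addrAC.
apply: etrans (IH F1 us mF1 (fun M => F0 _)) _.
transitivity (\int[mu]_M (fun N => F N * (e N)%:E)
    (M + D p.1 p.2 *: delta_mx p.1 p.2)%R)%E.
  apply: eq_integral => M _; congr (_ * (expR _)%:E)%E.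
  (* As [p] is not in [s], shifting the entry [p] leaves the weight of the other entries
     unchanged. *)
  apply: eq_big_seq => q qs; rewrite !mxE.
  case: (q =P p) => [qp|/eqP qp]; first by rewrite qp (negbTE ps) in qs.
  have -> : (q.1 == p.1) && (q.2 == p.2) = (q == p).
    by rewrite [q]surjective_pairing [p in RHS]surjective_pairing xpair_eqE.
  by rewrite (negbTE qp) mulr0 addr0.
rewrite (@cameron_martin_entry p (D p.1 p.2) (fun N => F N * (e N)%:E)%E)//.
- apply: eq_integral => M _; rewrite -muleA -EFinM -expRD big_cons.
  by congr (_ * (expR _)%:E)%E; rewrite addrC.
- exact: emeasurable_funM.
- by move=> M; rewrite mule_ge0// lee_fin expR_ge0.
Qed.

Lemma cameron_martin (D : 'M[R]_(m, n)) (F : MX -> \bar R) :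
  measurable_fun [set: MX] F -> (forall M, 0 <= F M)%E ->
  (\int[mu]_M F (M + D)%R =
   \int[mu]_M (F M * (expR (mxdot D M - mxdot D D / 2))%:E))%E.
Proof.
move=> mF F0.
have eD : D = \sum_(p <- index_enum ('I_m * 'I_n)%type) D p.1 p.2 *: delta_mx p.1 p.2.
  by rewrite {1}[D]matrix_sum_delta pair_big.
rewrite {1}eD.
apply: etrans (cameron_martin_seq D (index_enum_uniq _) mF F0) _.
apply: eq_integral => M _.
congr (_ * (expR _)%:E)%E; rewrite /mxdot !pair_big/= mulr_suml -sumrB.
by apply: eq_bigr => p _; rewrite expr2.
Qed.

(* The Cameron-Martin formula along the line R D already determines the law of
   V = <D, M>: with phi the standard normal density, translation invariance of
   Lebesgue measure, Tonelli and Cameron-Martin give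
     int_A phi = E int (1_A phi)(V + s) ds
               = E [1_A(V) int phi(V) exp(s V - s^2 / 2) ds] = P(V in A),
   because phi(V) exp(s V - s^2 / 2) = phi(V - s). *)
Lemma mxdot_std_normal (D : 'M[R]_(m, n)) (A : set R) :
  mxdot D D = 1 -> measurable A ->
  mu [set M | A (mxdot D M)] = normal_prob 0 1 A.
Proof.
move=> D1 mA; apply/esym.
have mI : measurable_fun [set: R] (fun x => (\1_A x : R)%:E).
  by apply/measurable_EFinP; exact: measurable_indic.
have mphi : measurable_fun [set: R] (fun x : R => (normal_pdf 0 1 x)%:E).
  by apply/measurable_EFinP; exact: measurable_normal_pdf.
pose H (x : R) : \bar R := ((normal_pdf 0 1 x)%:E * (\1_A x)%:E)%E.
have mH : measurable_fun [set: R] H by exact: emeasurable_funM.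
have H0 x : (0 <= H x)%E by rewrite mule_ge0// lee_fin// normal_pdf_ge0.
have mV := @measurable_mxdot R m n D.
transitivity (\int[mu]_M (normal_prob 0 1 A))%E.
  by rewrite integral_cst//= [X in (_ * X)%E]probability_setT mule1.
transitivity (\int[mu]_M \int[lebesgue_measure]_s H (mxdot D M + s)%R)%E.
  apply: eq_integral => M _; rewrite /normal_prob [LHS]integral_setI_indicE.
  rewrite -(integral_shift (mxdot D M) mH H0).
  by apply: eq_integral => x _; rewrite addrC.
rewrite (@fubini_tonelli _ _ _ _ _ mu lebesgue_measure
  (fun p => H (mxdot D p.1 + p.2)%R))/=; first last.
- by move=> p; exact: H0.
- apply: (measurableT_comp mH); apply: measurable_funD => //.
  exact: (measurableT_comp mV measurable_fst).
transitivity (\int[lebesgue_measure]_s \int[mu]_M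
    (H (mxdot D M) * (expR (s * mxdot D M - s ^+ 2 / 2))%:E))%E.
  apply: eq_integral => s _.
  transitivity (\int[mu]_M (fun N => H (mxdot D N)) (M + s *: D)%R)%E.
    by apply: eq_integral => M _ /=; rewrite mxdotDr mxdotZr D1 mulr1.
  apply: etrans (cameron_martin (s *: D) (measurableT_comp mH mV) (fun M => H0 _)) _.
  by apply: eq_integral => M _; rewrite !mxdotZl mxdotZr D1 mulr1 -expr2.
rewrite -(@fubini_tonelli _ _ _ _ _ mu lebesgue_measure (fun p =>
  (H (mxdot D p.1) * (expR (p.2 * mxdot D p.1 - p.2 ^+ 2 / 2))%:E)%E))/=; first last.
- by move=> p; rewrite mule_ge0// lee_fin expR_ge0.
- have m1 : measurable_fun [set: MX * measurableTypeR R] (fun p => mxdot D p.1).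
    exact: (measurableT_comp mV measurable_fst).
  apply: emeasurable_funM; first exact: (measurableT_comp mH m1).
  apply/measurable_EFinP; apply: measurableT_comp => //.
  apply: measurable_funB; first by apply: measurable_funM => //; exact: measurable_snd.
  apply: measurable_funM => //; apply: measurable_funX; exact: measurable_snd.
transitivity (\int[mu]_M (\1_[set M | A (mxdot D M)] M)%:E)%E; last first.
  by rewrite integral_indic// ?setIT// -[X in measurable X]setTI; exact: mV.
apply: eq_integral => M _.
transitivity (\int[lebesgue_measure]_s
    ((\1_A (mxdot D M))%:E * (normal_pdf 0 1 (s - mxdot D M))%:E))%E.
  apply: eq_integral => s _; rewrite /H muleAC -EFinM normal_pdf_shift muleC.
  by rewrite !normal_pdf_std -(sqrrN (s - _)) opprB.
rewrite ge0_integralZl//; first last.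
- by move=> s _; rewrite lee_fin normal_pdf_ge0.
- by apply: (measurableT_comp mphi); exact: measurable_funB.
rewrite (integral_shift (- mxdot D M) mphi); last first.
  by move=> s; rewrite lee_fin normal_pdf_ge0.
by rewrite integral_normal_pdf mule1.
Qed.

End gaussian_matrix.
(** * The optimal test *)

Lemma normal_prob_Phi (R : realType) (x : R) :
  normal_prob 0 1 `]-oo, x] = (Phi x)%:E.
Proof.
rewrite /Phi fineK//.
exact: (@fin_num_measure _ _ _ (normal_prob 0 1 : probability _ R)).
Qed.

(** The reflection at 0 preserves both Lebesgue measure and the density. *)
Lemma normal_prob_ge (R : realType) (a : R) :
  normal_prob 0 1 `[a, +oo[ = (Phi (- a))%:E.
Proof.
rewrite -normal_prob_Phi /normal_prob.
have -> : `]-oo, (- a)%R]%classic = (-%R : _ -> measurableTypeR R) @^-1` `[a, +oo[.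
  by apply/seteqP; split => x /=; rewrite !in_itv/= andbT lerNr.
transitivity (\int[lebesgue_measure]_(x in
    (-%R : _ -> measurableTypeR R) @^-1` `[a, +oo[)
    ((fun y : R => (normal_pdf 0 1 y)%:E) \o -%R) x)%E; last first.
  by apply: eq_integral => x _; rewrite /= !normal_pdf_std sqrrN.
rewrite -ge0_integral_pushforward//=; first last.
- by move=> x _; rewrite lee_fin normal_pdf_ge0.
- by apply/measurable_EFinP; apply: measurable_funTS; exact: measurable_normal_pdf.
by apply: eq_measure_integral => //= A mA _; exact/esym/lebesgue_measureN.
Qed.

Section neyman_pearson.
Variables (R : realType) (m n : nat).
Local Notation MX := (g_sigma_algebraType (@entry_sets R m n)).
Variable mu : probability MX R.
Hypothesis mu_rect : forall B : 'I_m -> 'I_n -> set R,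
  (forall i j, measurable (B i j)) ->
  mu (mx_rect B) = (\prod_(i < m) \prod_(j < n) normal_prob 0 1 (B i j))%E.
Variables (eps t : R) (D : 'M[R]_(m, n)).
Hypotheses (t0 : 0 < t) (Dt : mxdot D D = t ^+ 2).

Let rho (M : MX) : R := expR (mxdot D M - t ^+ 2 / 2).

Let measurable_rho : measurable_fun [set: MX] rho.
Proof.
apply: measurableT_comp => //; apply: measurable_funB => //.
exact: measurable_mxdot.
Qed.

Lemma prob_shift (O : set MX) : measurable O ->
  (mu [set M | O (M + D)%R] = \int[mu]_M ((\1_O M)%:E * (rho M)%:E))%E.
Proof.
move=> mO.
have mI : measurable_fun [set: MX] (fun M => (\1_O M : R)%:E).
  by apply/measurable_EFinP; exact: measurable_indic.
have I0 M : (0 <= (\1_O M : R)%:E)%E by rewrite lee_fin.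
have mOD : measurable ([set M | O (M + D)] : set MX).
  by rewrite -[X in measurable X]setTI; exact: measurable_addmx.
transitivity (\int[mu]_M (\1_O (M + D)%R : R)%:E)%E.
  transitivity (\int[mu]_M (\1_[set M | O (M + D)] M)%:E)%E.
    by rewrite integral_indic// setIT.
  apply: eq_integral => M _; rewrite !indicE.
  by have -> : (M \in [set M | O (M + D)]) = (M + D \in O) by apply/idP/idP; rewrite !inE.
by rewrite /rho -Dt; exact: (cameron_martin mu_rect D mI I0).
Qed.

(** The half-space where the likelihood ratio [rho] is at least e^eps, after taking logarithms. *)
Definition np_region : set MX := [set M | eps + t ^+ 2 / 2 <= mxdot D M].

Lemma measurable_np_region : measurable np_region.
Proof.
rewrite [X in measurable X](_ : _ = (fun M => mxdot D M) @^-1` `[eps + t ^+ 2 / 2, +oo[).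
  by rewrite -[X in measurable X]setTI; exact: measurable_mxdot.
by apply/seteqP; split => M /=; rewrite in_itv/= andbT.
Qed.

(** Dividing [D] by its norm [t] gives a unit direction, along which the law is standard normal. *)
Let mxdot_unit_ge (a : R) :
  mu [set M | a <= mxdot D M] = (Phi (- (a / t)))%:E.
Proof.
rewrite -normal_prob_ge -(mxdot_std_normal mu_rect (D := t^-1 *: D))//.
  congr (mu _); apply/seteqP; split => M /=;
    by rewrite in_itv/= andbT mxdotZl ler_pdivrMr// mulrC mulVKf ?gt_eqF.
by rewrite mxdotZl mxdotZr Dt expr2 mulKf ?gt_eqF// mulVf ?gt_eqF.
Qed.

Lemma prob_np_region : mu np_region = (Phi (- (t / 2) - eps / t))%:E.
Proof.
rewrite mxdot_unit_ge; congr (Phi _)%:E; field.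
by rewrite gt_eqF.
Qed.

Lemma prob_np_region_shift :
  mu [set M | np_region (M + D)] = (Phi (t / 2 - eps / t))%:E.
Proof.
(* The shift adds <D, D> = t^2 to the inner product. *)
have -> : [set M | np_region (M + D)] = [set M | eps - t ^+ 2 / 2 <= mxdot D M].
  apply/seteqP; split => M; rewrite /np_region /= mxdotDr Dt => H; lra.
rewrite mxdot_unit_ge; congr (Phi _)%:E; field.
by rewrite gt_eqF.
Qed.

(** Stated with sums instead of differences, so that both sides are integrals of nonnegative
    functions and compare pointwise. *)
Lemma neyman_pearson (O : set MX) : measurable O ->
  (mu [set M | O (M + D)%R] + (expR eps)%:E * mu np_region <=
   mu [set M | np_region (M + D)%R] + (expR eps)%:E * mu O)%E.
Proof.
move=> mO; have mH := measurable_np_region.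
have Z C : measurable C ->
    ((expR eps)%:E * mu C = \int[mu]_M ((expR eps)%:E * (\1_C M)%:E))%E.
  move=> mC; rewrite ge0_integralZl_EFin ?expR_ge0//.
    by rewrite integral_indic// setIT.
  by apply/measurable_EFinP; exact: measurable_indic.
have m1 C : measurable C -> measurable_fun [set: MX] (fun M => (\1_C M : R)%:E * (rho M)%:E)%E.
  by move=> mC; apply: emeasurable_funM; apply/measurable_EFinP => //; exact: measurable_indic.
have m2 C : measurable C -> measurable_fun [set: MX] (fun M => (expR eps)%:E * (\1_C M : R)%:E)%E.
  by move=> mC; apply: emeasurable_funM; apply/measurable_EFinP => //; exact: measurable_indic.
have p1 C M : (0 <= (\1_C M : R)%:E * (rho M)%:E)%E.
  by rewrite mule_ge0// lee_fin// expR_ge0.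
have p2 C (M : MX) : (0 <= (expR eps)%:E * (\1_C M : R)%:E)%E.
  by rewrite mule_ge0// lee_fin// expR_ge0.
rewrite !prob_shift// !Z//.
rewrite -!ge0_integralD//; [|exact: m1|exact: m2|exact: m1|exact: m2].
apply: ge0_le_integral => //.
- by move=> M _; rewrite adde_ge0.
- by apply: emeasurable_funD; [exact: m1|exact: m2].
- by apply: emeasurable_funD; [exact: m1|exact: m2].
(* pointwise (rho - e^eps) (1_O - 1_H) <= 0, as H = {rho >= e^eps} *)
move=> M _; rewrite -!EFinM -!EFinD lee_fin !indicE.
have [HM|HM] := pselect (np_region M).
  rewrite (mem_set HM).
  have er : expR eps <= rho M by rewrite ler_expR lerBrDr.
  by move: (M \in O) (expR eps) (rho M) er => b e r er; case: b => /=; lra.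
rewrite (memNset HM).
have er : rho M <= expR eps.
  by rewrite ler_expR lerBlDr; apply/ltW; rewrite ltNge; apply/negP.
by move: (M \in O) (expR eps) (rho M) er => b e r er; case: b => /=; lra.
Qed.

(** Testing on [np_region] gives one direction; its optimality among all tests gives the other. *)
Lemma privacy_profile (delta : R) :
  (forall O : set MX, measurable O ->
    (mu [set M | O (M + D)%R] <= (expR eps)%:E * mu O + delta%:E)%E) <->
  g eps t <= delta.
Proof.
split=> [H|gd O mO].
  have := H _ measurable_np_region.
  rewrite prob_np_region_shift prob_np_region -EFinM -EFinD lee_fin /g.
  by rewrite lerBlDl.
have := neyman_pearson mO; rewrite prob_np_region_shift prob_np_region.
have mOD : measurable ([set M | O (M + D)] : set MX).
  by rewrite -[X in measurable X]setTI; exact: measurable_addmx.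
rewrite -(fineK (fin_num_measure mu _ mO)) -(fineK (fin_num_measure mu _ mOD)).
rewrite -!EFinM -!EFinD !lee_fin => H.
move: gd; rewrite /g; lra.
Qed.

End neyman_pearson.
(** Passes from the underlying probability space to the law of [W] on matrices, where the
    Cameron-Martin formula lives. *)
Lemma iid_std_normal_law (R : realType) d (T : measurableType d)
    (P : probability T R) m n (W : T -> 'M[R]_(m, n)) :
  iid_std_normal P W ->
  exists mu : probability (g_sigma_algebraType (@entry_sets R m n)) R,
    (forall A, mu A = P (W @^-1` A)) /\
    forall B : 'I_m -> 'I_n -> set R, (forall i j, measurable (B i j)) ->
      mu (mx_rect B) = (\prod_(i < m) \prod_(j < n) normal_prob 0 1 (B i j))%E.
Proof.
move=> [mW lawW prodW].
have mWX : measurable_fun [set: T] (W : T -> g_sigma_algebraType (@entry_sets R m n)).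
  exact: measurable_fun_mx.
pose X : {mfun T >-> g_sigma_algebraType (@entry_sets R m n)} :=
  HB.pack (W : T -> g_sigma_algebraType (@entry_sets R m n))
    (isMeasurableFun.Build _ _ _ _ _ mWX).
exists (distribution P X : probability _ R); split => // B mB.
apply: etrans (prodW B mB) _.
by apply: eq_bigr => i _; apply: eq_bigr => j _; exact: lawW.
Qed.

Lemma measurable_affine_mx (R : realType) m n (C : 'M[R]_(m, n)) (A : 'M[R]_m) (B : 'M[R]_n) :
  let MX := g_sigma_algebraType (@entry_sets R m n) in
  measurable_fun [set: MX] (fun M : MX => (C + A *m M *m B : MX)).
Proof.
apply: measurable_fun_mx => i j.
under eq_fun do rewrite !mxE.
apply: measurable_funD => //; apply: measurable_sum => k.
apply: measurable_funM => //.
under eq_fun do rewrite !mxE.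
apply: measurable_sum => l; apply: measurable_funM => //.
exact: measurable_entry.
Qed.

(** * Whitening *)

Definition whiten (R : realType) m n (U1 : 'M[R]_m) (U2 : 'M[R]_n)
  (D : 'M[R]_(m, n)) := invmx U1 *m D *m (invmx U2)^T.

Section whiten.
Variables (R : realType) (m n : nat).

Lemma whitenK (U1 : 'M[R]_m) (U2 : 'M[R]_n) (D : 'M[R]_(m, n)) :
  U1 \in unitmx -> U2 \in unitmx -> U1 *m whiten U1 U2 D *m U2^T = D.
Proof.
move=> u1 u2; rewrite /whiten !mulmxA mulmxV// mul1mx -mulmxA -trmx_mul.
by rewrite mulmxV// trmx1 mulmx1.
Qed.

(** The whitened norm depends on the factors only through the covariances. The factors that witness
    [matrix_normal] may thus be exchanged for the given ones. *)
Lemma mxdot_whiten (U1 : 'M[R]_m) (U2 : 'M[R]_n) (D : 'M[R]_(m, n)) :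
  U1 \in unitmx -> U2 \in unitmx ->
  mxdot (whiten U1 U2 D) (whiten U1 U2 D) =
  mxdot D (invmx (U1 *m U1^T) *m D *m invmx (U2 *m U2^T)).
Proof.
move=> u1 u2.
have inv k (U : 'M[R]_k) : U \in unitmx -> invmx (U *m U^T) = (invmx U)^T *m invmx U.
  move=> uU.
  have uUU : U *m U^T \in unitmx by rewrite unitmx_mul unitmx_tr uU.
  rewrite -[LHS]mulmx1 -[RHS](mulKmx uUU); congr (_ *m _).
  by rewrite -mulmxA [U^T *m _]mulmxA -trmx_mul mulVmx// trmx1 mul1mx mulmxV.
rewrite !inv// /whiten -[in LHS]mulmxA mxdot_mull -(mxdot_tr (D *m _)) trmx_mul.
rewrite trmxK mxdot_mull -mxdot_tr !trmx_mul !trmxK.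
by rewrite !mulmxA.
Qed.

Lemma whitenZ (U1 : 'M[R]_m) (U2 : 'M[R]_n) c (D : 'M[R]_(m, n)) :
  whiten U1 U2 (c *: D) = c *: whiten U1 U2 D.
Proof. by rewrite /whiten -scalemxAr -scalemxAl. Qed.

(** Write D = U1 W U2^T with W the whitened matrix, and bound the effect of each factor by its least
    singular value. *)
Lemma sigma_whiten_le (U1 : 'M[R]_m) (U2 : 'M[R]_n) (D : 'M[R]_(m, n)) :
  (0 < m)%N -> (0 < n)%N -> U1 \in unitmx -> U2 \in unitmx ->
  sigma m U1 * sigma n U2 * frobenius_norm (whiten U1 U2 D) <= frobenius_norm D.
Proof.
move=> m0 n0 u1 u2.
have [s1 le1 _] := sigma_min m0 u1; have [s2 le2 _] := sigma_min n0 u2.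
have lem k l (U : 'M[R]_k) (s : R) (V : 'M[R]_(k, l)) :
    (forall v : 'cV_k, s ^+ 2 * mxdot v v <= mxdot (U *m v) (U *m v)) ->
    s ^+ 2 * mxdot V V <= mxdot (U *m V) (U *m V).
  move=> H; rewrite !(mxdot_col) mulr_sumr; apply: ler_sum => j _.
  by apply: le_trans (H _) _; rewrite !colE mulmxA.
rewrite -(@ler_pXn2r _ 2)// ?nnegrE ?frobenius_norm_ge0//; last first.
  by rewrite !mulr_ge0// ?frobenius_norm_ge0// ltW.
rewrite !exprMn !frobenius_norm_sqr.
rewrite -[in leRHS](whitenK D u1 u2); move: (whiten U1 U2 D) => W.
rewrite -mulmxA -mulrA; apply: le_trans (lem _ _ _ _ _ le1).
rewrite ler_pM2l ?exprn_gt0//.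
(* Transposing turns the right factor into a left one, so that the same column bound applies. *)
rewrite -(mxdot_tr W) -(mxdot_tr (W *m _)) !trmx_mul trmxK.
exact: lem le2.
Qed.

(** The extremal direction is (U1 v1)(U2 v2)^T, normalised, where each vk attains the least singular
    value of Uk; norms of outer products multiply. *)
Lemma sigma_whiten_eq (U1 : 'M[R]_m) (U2 : 'M[R]_n) :
  (0 < m)%N -> (0 < n)%N -> U1 \in unitmx -> U2 \in unitmx ->
  exists2 E : 'M[R]_(m, n), frobenius_norm E = 1 &
    sigma m U1 * sigma n U2 * frobenius_norm (whiten U1 U2 E) = 1.
Proof.
move=> m0 n0 u1 u2.
have [s1 _ [v1 v10 e1]] := sigma_min m0 u1.
have [s2 _ [v2 v20 e2]] := sigma_min n0 u2.
have outer k l (a : 'cV[R]_k) (b : 'cV[R]_l) :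
    mxdot (a *m b^T) (a *m b^T) = mxdot a a * mxdot b b.
  rewrite mxdot_mull.
  have -> : a^T *m (a *m b^T) = mxdot a a *: b^T.
    rewrite mulmxA [a^T *m a]mx11_scalar mul_scalar_mx; congr (_ *: _).
    by rewrite mxdotE /mxtrace big_ord1.
  by rewrite mxdotZr mxdot_tr.
pose W := v1 *m v2^T; pose E0 := U1 *m W *m U2^T.
have W0 : 0 < frobenius_norm W.
  rewrite sqrtr_gt0 -[X in 0 < X]/(mxdot W W) outer mulr_gt0//.
    by rewrite lt_def mxdot_eq0 v10 mxdot_ge0.
  by rewrite lt_def mxdot_eq0 v20 mxdot_ge0.
have WE : whiten U1 U2 E0 = W.
  rewrite /whiten /E0 !mulmxA mulVmx// mul1mx -!mulmxA -trmx_mul mulVmx//.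
  by rewrite trmx1 mulmx1.
have nE : frobenius_norm E0 = sigma m U1 * sigma n U2 * frobenius_norm W.
  apply/eqP; rewrite -(@eqrXn2 _ 2)// ?frobenius_norm_ge0//; last first.
    by rewrite !mulr_ge0// ltW.
  rewrite !exprMn !frobenius_norm_sqr /E0 /W.
  have -> : U1 *m (v1 *m v2^T) *m U2^T = (U1 *m v1) *m (U2 *m v2)^T.
    by rewrite trmx_mul !mulmxA.
  by rewrite !outer e1 e2; apply/eqP; ring.
have E00 : 0 < frobenius_norm E0 by rewrite nE !mulr_gt0.
have iE0 : 0 <= (frobenius_norm E0)^-1 by rewrite invr_ge0 ltW.
exists ((frobenius_norm E0)^-1 *: E0).
  by rewrite frobenius_normZ ger0_norm// mulVf ?gt_eqF.
by rewrite whitenZ frobenius_normZ ger0_norm// WE mulrCA -nE mulVf// gt_eqF.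
Qed.

End whiten.

(** * From the optimal test to the mechanism *)

(** Reflection in the hyperplane orthogonal to u = D - E. Equal norms give 2<D, u> = <u, u>, hence Q
    D = D - u = E. The two other properties ensure that composing a query with Q keeps its
    sensitivity. *)
Lemma householder (R : realType) m n (D E : 'M[R]_(m, n)) :
  frobenius_norm D = frobenius_norm E ->
  exists Q : 'M[R]_(m, n) -> 'M[R]_(m, n),
    [/\ Q D = E, forall A B, Q A - Q B = Q (A - B)
      & forall A, frobenius_norm (Q A) = frobenius_norm A].
Proof.
move=> /(congr1 (fun x => x ^+ 2)); rewrite !frobenius_norm_sqr => DE.
pose u := D - E; pose Q A := A - (2 * mxdot A u / mxdot u u) *: u.
have [u0|u0] := eqVneq u 0.
  by exists id; split => //; apply/eqP; rewrite -subr_eq0 -/u u0.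
have uu : mxdot u u != 0 by rewrite mxdot_eq0.
have mxdotNr (A B : 'M[R]_(m, n)) : mxdot A (- B) = - mxdot A B.
  by rewrite -scaleN1r mxdotZr mulN1r.
exists Q; split.
- rewrite /Q; have -> : 2 * mxdot D u = mxdot u u.
    rewrite [in RHS]/u mxdotDl -/u -scaleN1r mxdotZl /u !mxdotDr !mxdotNr -DE.
    by rewrite [mxdot E D]mxdotC; ring.
  by rewrite divff// scale1r /u opprB addrC subrK.
- move=> A B; rewrite /Q mxdotDl -[mxdot (- B) u]mxdotC mxdotNr (mxdotC u).
  rewrite mulrBr mulrBl scalerBl !opprD !opprK; exact: addrACA.
- move=> A; rewrite /Q; move: (u) uu => v vv.
  rewrite !frobenius_normE; congr Num.sqrt.
  rewrite -scaleNr !mxdotDl !mxdotDr !mxdotZl !mxdotZr (mxdotC v A).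
  by field.
Qed.

(** The case a = b stands apart because the half-space test needs a nonzero direction; there eps >=
    0 and delta >= 0 suffice. *)
Lemma gaussian_mechanism_pair (R : realType) d (T : measurableType d)
    (P : probability T R) m n (Z : T -> 'M[R]_(m, n))
    (U1 : 'M[R]_m) (U2 : 'M[R]_n) (eps delta : R) (a b : 'M[R]_(m, n)) :
  0 <= eps -> 0 <= delta -> U1 \in unitmx -> U2 \in unitmx ->
  matrix_normal P Z 0 (U1 *m U1^T) (U2 *m U2^T) ->
  (forall O : set 'M[R]_(m, n), measurable_mx O ->
     (P [set w | O (a + Z w)%R] <= (expR eps)%:E * P [set w | O (b + Z w)%R] + delta%:E)%E)
  <-> (a = b \/ g eps (frobenius_norm (whiten U1 U2 (a - b))) <= delta).
Proof.
move=> e0 d0 u1 u2 [V1 [V2 [v1 v2 eV1 eV2 iidW]]].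
have [mu [muE mu_rect]] := iid_std_normal_law iidW.
set W := fun w => _ in iidW muE.
have [<-|ab] := eqVneq a b.
  split=> [_|_ O mO]; first by left.
  have e1 : 1 <= expR eps by rewrite -expR0 ler_expR.
  set p := P _; have p0 : (0 <= p)%E by exact: measure_ge0.
  apply: (@le_trans _ _ ((expR eps)%:E * p)%E); first by rewrite lee_pemull// lee_fin.
  by rewrite leeDl ?lee_fin.
pose D := whiten V1 V2 (a - b).
have D0 : D != 0.
  apply: contra_neq ab => D0; apply/eqP; rewrite -subr_eq0.
  by rewrite -(whitenK (a - b) v1 v2) -/D D0 mulmx0 mul0mx.
have nD : frobenius_norm D = frobenius_norm (whiten U1 U2 (a - b)).
  by rewrite !frobenius_normE !mxdot_whiten// eV1 eV2.
have t0 : 0 < frobenius_norm D.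
  by rewrite frobenius_normE sqrtr_gt0 lt_def mxdot_eq0 D0 mxdot_ge0.
have Dt : mxdot D D = frobenius_norm D ^+ 2 by rewrite frobenius_norm_sqr.
have pp := privacy_profile mu_rect eps t0 Dt delta.
have wD (A B : 'M[R]_(m, n)) : whiten V1 V2 (A + B) = whiten V1 V2 A + whiten V1 V2 B.
  by rewrite /whiten mulmxDr mulmxDl.
have ZW w : Z w = V1 *m W w *m V2^T.
  by rewrite /W -{1}(whitenK (Z w) v1 v2) subr0.
have WZ w : W w = whiten V1 V2 (Z w) by rewrite /W subr0.
(* Adding [D] to the whitened noise moves the centre from [b] to [a]. *)
have key N : b + V1 *m (N + D) *m V2^T = a + V1 *m N *m V2^T.
  by rewrite mulmxDr mulmxDl whitenK// addrCA subrKC addrC.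
rewrite -nD; split=> [H|[/eqP|gd O mO]]; last 2 first.
- by rewrite (negbTE ab).
- pose O' := [set M | O (b + V1 *m M *m V2^T)].
  have mO' : (measurable : set (set (g_sigma_algebraType (@entry_sets R m n)))) O'.
    by rewrite -[X in measurable X]setTI; exact: (@measurable_affine_mx R m n b V1 V2^T).
  have := (pp.2 gd) O' mO'; rewrite !muE.
  have -> : W @^-1` [set M | O' (M + D)] = [set w | O (a + Z w)].
    by apply/funext => w; rewrite /preimage /O' /= key ZW.
  by have -> : W @^-1` O' = [set w | O (b + Z w)] by apply/funext => w; rewrite /preimage /O' /= ZW.
right; apply/pp => O mO.
(* Centring at [b] and whitening turns a test on [W] into a test on the outputs. *)
pose O' := [set N | O (whiten V1 V2 (N - b))].
have mO' : measurable_mx O'.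
  have -> : O' = (fun N => - whiten V1 V2 b + invmx V1 *m N *m (invmx V2)^T) @^-1` O.
    apply/funext => N; rewrite /preimage /O' /= addrC wD; congr (O (_ + _)).
    by rewrite -scaleN1r whitenZ scaleN1r.
  by rewrite -[X in measurable_mx X]setTI; exact: (@measurable_affine_mx R m n).
have := H O' mO'; rewrite !muE.
have -> : W @^-1` [set M | O (M + D)] = [set w | O' (a + Z w)].
  by apply/funext => w; rewrite /preimage /O' /= WZ -wD addrA addrAC [_ + a]addrC -addrA.
suff -> : W @^-1` O = [set w | O' (b + Z w)] by [].
by apply/funext => w; rewrite /preimage /O' /= WZ addrAC subrr add0r.
Qed.
(** Privacy is asked of all queries with the sensitivity of [f]: the differences of a single [f] may
    avoid the worst direction, and then less noise can suffice. *)
Theorem theorem2 (R : realType) (X : Type) (dist : X -> X -> nat)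
    (m n : nat) (hm : (0 < m)%N) (hn : (0 < n)%N)
    (f : X -> 'M[R]_(m, n))
    (eps delta : R) (heps : 0 < eps) (hdelta0 : 0 < delta) (hdelta1 : delta < 1)
    (B : R) (hB : 0 < B) (hgB : g eps B = delta)
    (U1 S1 : 'M[R]_m) (U2 S2 : 'M[R]_n)
    (hU1 : U1 \in unitmx) (hU2 : U2 \in unitmx)
    (hS1 : U1 *m U1^T = S1) (hS2 : U2 *m U2^T = S2)
    (d : measure_display) (T : measurableType d) (P : probability T R)
    (Z : T -> 'M[R]_(m, n)) (hZ : matrix_normal P Z 0 S1 S2) :
  (forall h : X -> 'M[R]_(m, n), sensitivity dist h = sensitivity dist f ->
     differentially_private P dist eps delta (additive_mechanism h Z)) <->
  (sensitivity dist f / B%:E <= (sigma m U1 * sigma n U2)%:E)%E.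
Proof.
have n1 := sigma_min hm hU1; have n2 := sigma_min hn hU2.
set s := sigma m U1 * sigma n U2.
have s0 : 0 < s by case: n1 n2 => s1 _ _ [s2 _ _]; rewrite mulr_gt0.
have pairP (h : X -> 'M[R]_(m, n)) x x' :
    (forall O : set 'M[R]_(m, n), measurable_mx O ->
      (P (additive_mechanism h Z x @^-1` O) <=
       (expR eps)%:E * P (additive_mechanism h Z x' @^-1` O) + delta%:E)%E) <->
    (h x = h x' \/ g eps (frobenius_norm (whiten U1 U2 (h x - h x'))) <= delta).
  by apply: gaussian_mechanism_pair => //; [exact: ltW|exact: ltW|rewrite hS1 hS2].
(* As B > 0, the condition becomes sensitivity <= s B, still between extended reals. *)
rewrite inver gt_eqF// lee_pdivrMr// -EFinM.
split=> [dp|sens h hsens x x' xx'].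
  apply: ge_ereal_sup => _ [x [x' [xx' ->]]]; rewrite lee_fin.
  have [fe|fne] := eqVneq (f x - f x') 0.
    by rewrite fe frobenius_normE (eqP (_ : mxdot 0 0 == 0)) ?mxdot_eq0// sqrtr0 mulr_ge0// ltW.
  set r := frobenius_norm (f x - f x').
  have r0 : 0 < r by rewrite sqrtr_gt0 lt_def mxdot_ge0 andbT mxdot_eq0.
  (* [E] is the worst unit direction. Reflecting f x - f x' onto r E gives a query whose whitened
     difference has norm r / s. *)
  have [E E1 WE] := sigma_whiten_eq hm hn hU1 hU2.
  have nE : frobenius_norm (r *: E) = r by rewrite frobenius_normZ ger0_norm ?ltW// E1 mulr1.
  have [Q [QD Qsub Qnorm]] := householder (esym nE : frobenius_norm (f x - f x') = _).
  have sQ : sensitivity dist (Q \o f) = sensitivity dist f.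
    congr ereal_sup; apply/seteqP; split => _ [y [y' [yy' ->]]]; exists y, y'; split=> //=;
      by rewrite Qsub Qnorm.
  have /pairP := dp _ sQ x x' xx'.
  rewrite /= Qsub QD whitenZ frobenius_normZ (ger0_norm (ltW r0)).
  case=> [/eqP|].
    (* Equal values would force r E = 0, against r > 0. *)
    rewrite -subr_eq0 Qsub QD => /eqP rE; move: nE.
    rewrite rE -(scale0r 0) frobenius_normZ normr0 mul0r.
    by move=> rr; rewrite -rr ltxx in r0.
  have -> : frobenius_norm (whiten U1 U2 E) = s^-1.
    by apply: (mulfI (lt0r_neq0 s0)); rewrite WE divff// gt_eqF.
  rewrite -hgB leNgt => gB; rewrite leNgt; apply: contra gB => sBr.
  by apply: g_increasing => //; rewrite ltr_pdivlMr// mulrC.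
apply/pairP; have [->|hne] := eqVneq (h x) (h x'); [by left|right].
set t := frobenius_norm _.
(* s t <= |h x - h x'| <= sensitivity <= s B. *)
have tB : t <= B.
  rewrite -(ler_pM2l s0) (le_trans (sigma_whiten_le (h x - h x') hm hn hU1 hU2))//.
  rewrite -lee_fin; apply: le_trans sens; rewrite -hsens; apply: ereal_sup_ubound.
  by exists x, x'.
have t0 : 0 < t.
  rewrite sqrtr_gt0 lt_def mxdot_ge0 andbT mxdot_eq0.
  apply: contra_neq hne => W0; apply/eqP; rewrite -subr_eq0.
  by rewrite -(whitenK (h x - h x') hU1 hU2) W0 mulmx0 mul0mx.
rewrite -hgB; move: tB; rewrite le_eqVlt => /predU1P[->//|tB].
by apply/ltW; exact: g_increasing.
Qed.
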